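(* Let $T$ be the Lr $(\mathbf a,\tau)$ interval exchange transformation with $\tau$ irreducible and $T$ satisfying the Keane Condition, and let $\alpha,\beta\in X$. (i) If $\alpha\ne\beta$, then $\alpha,\beta$ are positively asymptotic (i.e. $\alpha_i=\beta_i$ for all $i\ge N$, some $N$) if and only if there exist $i\in[n]$ (with $b^\tau_i\in D^\tau$) and $k\in\mathbb Z$ such that, with $x=b^\tau_i$, $\{\alpha,\beta\}=\{S^k\mathcal I(x),S^k\tilde{\mathcal I}(x)\}$. (ii) If $\alpha\ne\beta$, then $\alpha,\beta$ are negatively asymptotic (i.e. $\alpha_i=\beta_i$ for all $i\le -N$, some $N$) if and only if there exist $i$ with $b_i\in D$ and $k\in\mathbb Z$ such that, with $x=b_i$, $\{\alpha,\beta\}=\{S^k\mathcal I(x),S^k\tilde{\mathcal I}(x)\}$. (iii) If $\mathcal I(x)=\tilde{\mathcal I}(y)$ for some $x\in[0,1)$, $y\in(0,1]$, then $x=y$ and this common point lies in $R$. (iv) If in addition $\tau$ is fully split, then any doubly asymptotic pair $\alpha,\beta\in X$ satisfies $\alpha=\beta$. Conversely, if $\tau$ is not split, then $X$ contains a doubly asymptotic pair of distinct points.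
   Context: Fix $n\ge 2$, $[n]=\{1,\dots,n\}$, a vector $\mathbf a=(a_1,\dots,a_n)$ with all $a_i>0$ and $\sum_i a_i=1$, and a permutation $\tau$ of $[n]$. Put $b_0=0$, $b_i=\sum_{j=1}^i a_j$, $J_i=[b_{i-1},b_i)$, $\tilde J_i=(b_{i-1},b_i]$ for $i\in[n]$, and $D=\{b_1,\dots,b_{n-1}\}$. Put $b^\tau_0=0$, $b^\tau_i=\sum_{j=1}^i a_{\tau^{-1}(j)}$, $D^\tau=\{b^\tau_1,\dots,b^\tau_{n-1}\}$. The Lr $(\mathbf a,\tau)$ interval exchange transformation $T:[0,1)\to[0,1)$ and its dual $\tilde T:(0,1]\to(0,1]$ are defined by $x\mapsto x-b_{i-1}+b^\tau_{\tau(i)-1}$ for $x\in J_i$ (resp. $x\in\tilde J_i$); both are bijections. $\tau$ is irreducible if $\tau(\{1,\dots,j\})\ne\{1,\dots,j\}$ for $j=1,\dots,n-1$; split if $\tau(j+1)\ne\tau(j)+1$ for $j=1,\dots,n-1$; fully split if it is split and moreover $\tau(1)\ne\tau(n)+1$ and $\tau^{-1}(1)\ne\tau^{-1}(n)+1$. $T$ satisfies the Keane Condition if $D\cap T^k(D)=\emptyset$ for all $k\in\mathbb N$. Let $\Omega=[n]^{\mathbb Z}$ with the product topology and shift $S(\alpha)_i=\alpha_{i+1}$. The itinerary maps $\mathcal I:[0,1)\to\Omega$, $\tilde{\mathcal I}:(0,1]\to\Omega$ are $\mathcal I(x)_k=i\iff T^kx\in J_i$ and $\tilde{\mathcal I}(x)_k=i\iff\tilde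 T^kx\in\tilde J_i$ ($k\in\mathbb Z$). Let $D_\infty=\{0,1\}\cup\bigcup_{k\in\mathbb Z}T^k(D)$, $R=[0,1]\setminus D_\infty$ (the regular points), $X_0=\mathcal I(R)$, and $X=\overline{X_0}$. A pair is doubly asymptotic if it is both positively and negatively asymptotic. *)

(* Defs.v *)
From HB Require Import structures.
From mathcomp Require Import all_boot all_order all_algebra all_fingroup.
From mathcomp Require Import reals.
Set Implicit Arguments. Unset Strict Implicit. Unset Printing Implicit Defensive.
Import Order.TTheory GRing.Theory Num.Theory.
Local Open Scope ring_scope.

(* Conventions: letters of the alphabet [n] = {1..n} of the paper are
   represented 0-based by l : 'I_n (paper letter l+1), and the permutation
   tau : {perm 'I_n} is the paper's permutation shifted by one:
   tau_paper (l+1) = (tau l) + 1.  Symbolic sequences (points of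
   Omega = [n]^Z) are functions int -> nat with values in {1..n}
   (1-based, as in the paper). *)

Section IET.
Variables (R : realType) (n : nat) (a : 'I_n -> R) (tau : {perm 'I_n}).

Definition bpt (i : nat) : R := \sum_(j < n | (j < i)%N) a j.
Definition btau (i : nat) : R := \sum_(j < n | (tau j < i)%N) a j.

Definition inJ (l : 'I_n) (x : R) : bool := (bpt l <= x) && (x < bpt l.+1).
Definition inJt (l : 'I_n) (x : R) : bool := (bpt l < x) && (x <= bpt l.+1).
Definition inK (l : 'I_n) (y : R) : bool := (btau (tau l) <= y) && (y < btau (tau l).+1).
Definition inKt (l : 'I_n) (y : R) : bool := (btau (tau l) < y) && (y <= btau (tau l).+1).

(* The Lr (a,tau) IET  T : [0,1) -> [0,1)  (identity outside [0,1)) *)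
Definition T (x : R) : R :=
  match [pick l | inJ l x] with
  | Some l => x - bpt l + btau (tau l)
  | None => x end.
Definition Tt (x : R) : R :=
  match [pick l | inJt l x] with
  | Some l => x - bpt l + btau (tau l)
  | None => x end.
(* the inverse maps, written out explicitly (T maps J_l onto
   [b^tau_{tau l -1}, b^tau_{tau l}) by translation) *)
Definition Tinv (y : R) : R :=
  match [pick l | inK l y] with
  | Some l => y - btau (tau l) + bpt l
  | None => y end.
Definition Ttinv (y : R) : R :=
  match [pick l | inKt l y] with
  | Some l => y - btau (tau l) + bpt l
  | None => y end.

Definition Tpow (k : int) (x : R) : R :=
  match k with Posz m => iter m T x | Negz m => iter m.+1 Tinv x end.
Definition Ttpow (k : int) (x : R) : R :=
  match k with Posz m => iter m Tt x | Negz m => iter m.+1 Ttinv x end.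

Definition letter (x : R) : nat :=
  match [pick l | inJ l x] with Some l => (l : nat).+1 | None => 0%N end.
Definition lettert (x : R) : nat :=
  match [pick l | inJt l x] with Some l => (l : nat).+1 | None => 0%N end.

Definition itin (x : R) : int -> nat := fun k => letter (Tpow k x).
Definition itint (x : R) : int -> nat := fun k => lettert (Ttpow k x).

Definition inD (x : R) : Prop := exists i : nat, (0 < i < n)%N /\ x = bpt i.

Definition keane : Prop :=
  forall (k : nat) (d d' : R), (0 < k)%N -> inD d -> inD d' -> Tpow k%:Z d <> d'.

Definition regular (x : R) : Prop :=
  0 <= x <= 1 /\ x <> 0 /\ x <> 1 /\
  forall (k : int) (d : R), inD d -> x <> Tpow k d.

(* X = closure of X_0 = I(R) in Omega = [n]^Z with the product topology
   ([n] discrete): alpha is in the closure iff every basic cylinder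
   neighbourhood {beta | beta_j = alpha_j, |j| <= N} meets X_0. *)
Definition inX (alpha : int -> nat) : Prop :=
  forall N : nat, exists x : R, regular x /\
    forall j : int, `|j| <= N%:Z -> alpha j = itin x j.

End IET.

Definition shiftk (k : int) (alpha : int -> nat) : int -> nat :=
  fun i => alpha (i + k).

Definition pos_asymptotic (alpha beta : int -> nat) : Prop :=
  exists N : int, forall i : int, N <= i -> alpha i = beta i.
Definition neg_asymptotic (alpha beta : int -> nat) : Prop :=
  exists N : int, forall i : int, i <= - N -> alpha i = beta i.
Definition doubly_asymptotic (alpha beta : int -> nat) : Prop :=
  pos_asymptotic alpha beta /\ neg_asymptotic alpha beta.

Definition same_pair {A : Type} (alpha beta gamma delta : A) : Prop :=
  (alpha = gamma /\ beta = delta) \/ (alpha = delta /\ beta = gamma).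

Definition irreducible_perm (n : nat) (tau : {perm 'I_n}) : Prop :=
  forall j : nat, (0 < j < n)%N ->
    [set tau i | i : 'I_n & (i < j)%N] != [set i : 'I_n | (i < j)%N].
Definition split_perm (n : nat) (tau : {perm 'I_n}) : Prop :=
  forall i j : 'I_n, (j : nat) = i.+1 -> (tau j : nat) <> (tau i).+1.
Definition fully_split_perm (n : nat) (tau : {perm 'I_n}) : Prop :=
  split_perm tau /\
  (forall i0 i1 : 'I_n, (i0 : nat) = 0%N -> (i1 : nat) = n.-1 ->
     (tau i0 : nat) <> (tau i1).+1 /\
     ((tau^-1)%g i0 : nat) <> ((tau^-1)%g i1).+1).

(* Main.v *)
(* The dynamical input is that the letters of a one-sided orbit determine the
   point. Two points with the same letters bound an interval on which all powers
   of [T] (or of its inverse) are translations. By the pigeonhole principle some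
   power moves it by less than its length, hence always by the same amount, hence
   by zero: it consists of periodic points. Sliding a periodic point to the left
   until its orbit meets [D] or [0 = T d], [d] in [D], contradicts Keane.

   A point of [X] is therefore the itinerary of a point under [T] or under its
   dual, and asymptotic distinct pairs are the two itineraries of a common point.
   The two orbits of that point stay together backwards until they meet [D^tau],
   and forwards until they meet [D]. Since [D^tau] is contained in the union of
   [T D] and [T^2 D], Keane says that a point of [D^tau] never returns to [D],
   which yields the converse implications and rules out, when [tau] is fully
   split, that the same pair comes from both [D] and [D^tau]. *)
Require Import Defs.
From HB Require Import structures.
From mathcomp Require Import all_boot all_order all_algebra all_fingroup.
From mathcomp Require Import boolp classical_sets reals.
From mathcomp Require Import zify ring lra.
Set Implicit Arguments. Unset Strict Implicit. Unset Printing Implicit Defensive.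
Import Order.TTheory GRing.Theory Num.Theory.
Local Open Scope ring_scope.

(** * Breakpoints and the half-open intervals between them *)

Section Breakpoints.
Variables (R : realType) (n : nat) (a : 'I_n -> R) (sigma : {perm 'I_n}).
Hypotheses (a_gt0 : forall i, 0 < a i) (a_sum : \sum_(i < n) a i = 1).

(** With the identity permutation [btau] becomes [bpt], so each fact below serves the partitions of
    both the domain and the image. *)
Lemma bptE i : bpt a i = btau a 1%g i.
Proof. by apply: eq_bigl => j; rewrite perm1. Qed.

Lemma btau0 : btau a sigma 0 = 0.
Proof. by rewrite /btau big_pred0. Qed.

Lemma btau_n : btau a sigma n = 1.
Proof. by rewrite -a_sum; apply: eq_bigl => j; rewrite ltn_ord. Qed.

Lemma btauS l : btau a sigma (sigma l).+1 = btau a sigma (sigma l) + a l.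
Proof.
rewrite /btau (bigD1 l) ?ltnSn //= addrC; congr (_ + _).
apply: eq_bigl => j; rewrite ltnS -(inj_eq (@perm_inj _ sigma)) -val_eqE /=.
by lia.
Qed.

Lemma btau_ltS i : (i < n)%N -> btau a sigma i < btau a sigma i.+1.
Proof.
move=> lt_in; have := btauS ((sigma^-1)%g (Ordinal lt_in)).
by rewrite permKV /= => ->; rewrite ltrDl.
Qed.

Lemma btau_lt i j : (i < j <= n)%N -> btau a sigma i < btau a sigma j.
Proof.
elim: j => [|j IHj]; first by rewrite ltn0.
rewrite ltnS => /andP[]; rewrite leq_eqVlt => /predU1P[-> /btau_ltS //|lt_ij lt_jn].
by apply: lt_trans (btau_ltS lt_jn); apply: IHj; rewrite lt_ij ltnW.
Qed.

Lemma btau_le i j : (i <= j <= n)%N -> btau a sigma i <= btau a sigma j.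
Proof.
case/andP; rewrite leq_eqVlt => /predU1P[-> //|lt_ij le_jn].
by apply/ltW/btau_lt; rewrite lt_ij.
Qed.

Lemma btau_inj i j : (i <= n)%N -> (j <= n)%N ->
  btau a sigma i = btau a sigma j -> i = j.
Proof.
move=> le_in le_jn e; case: (ltngtP i j) => // lt_ij.
  by have := @btau_lt i j; rewrite lt_ij le_jn e ltxx => /(_ isT).
by have := @btau_lt j i; rewrite lt_ij le_in e ltxx => /(_ isT).
Qed.

Lemma btau_in01 i : (0 < i < n)%N -> 0 < btau a sigma i < 1.
Proof.
move=> /andP[i0 ltin]; rewrite -{1}btau0 -btau_n !btau_lt ?ltin ?i0 //=; lia.
Qed.

Definition dom (s : bool) (x : R) := if s then 0 <= x < 1 else 0 < x <= 1.

Definition Kside s l y := if s then inK a sigma l y else inKt a sigma l y.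

Lemma Kside_dom s l y : Kside s l y -> dom s y.
Proof.
have lt := ltn_ord (sigma l).
have h1 : btau a sigma 0 <= btau a sigma (sigma l) by apply: btau_le; lia.
have h2 : btau a sigma (sigma l).+1 <= btau a sigma n by apply: btau_le; lia.
move: h1 h2; rewrite btau0 btau_n.
by case: s => /=; rewrite /inK /inKt => h1 h2 /andP[h3 h4]; apply/andP; split; lra.
Qed.

(** The first breakpoint beyond [y], in the strict or weak sense that [s] prescribes, is the right
    end of its interval. *)
Lemma Kside_total s y : dom s y -> exists l, Kside s l y.
Proof.
move=> domy.
pose below i := if s then y < btau a sigma i else y <= btau a sigma i.
have ex : exists i, below i.
  by exists n; move: domy; rewrite /below btau_n; case: s {below} => /= /andP[].
case: (ex_minnP ex) => -[|i] bi min_i.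
  by move: bi domy; rewrite /below btau0; case: s {below ex min_i} => /= h /andP[]; lra.
have lt_in : (i < n)%N.
  apply: min_i; rewrite /below btau_n.
  by case: s domy {below ex bi} => /= /andP[].
have nbi : ~~ below i by apply/negP => /min_i; rewrite ltnn.
exists ((sigma^-1)%g (Ordinal lt_in)).
move: bi nbi; rewrite /below /Kside /inK /inKt permKV /=.
by case: s {below ex min_i domy} => /= ->; rewrite ?andbT -?leNgt -?ltNge.
Qed.

Lemma Kside_uniq s l l' y : Kside s l y -> Kside s l' y -> l = l'.
Proof.
move=> kl kl'; apply: (@perm_inj _ sigma); apply: val_inj => /=.
have disj (u v : 'I_n) : (u < v)%N -> btau a sigma u.+1 <= btau a sigma v.
  by move=> lt_uv; apply: btau_le; have := ltn_ord v; lia.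
case: (ltngtP (sigma l) (sigma l')) => // /disj dj; exfalso.
  by move: kl kl' dj; case: s => /= /andP[_ h1] /andP[h2 _]; lra.
by move: kl' kl dj; case: s => /= /andP[_ h1] /andP[h2 _]; lra.
Qed.

End Breakpoints.

(** * Two-sided induction on the integers, and points off a countable set *)

Lemma int_bi_ind (P : int -> Prop) :
  P 0 -> (forall k, P k <-> P (k + 1)) -> forall k, P k.
Proof.
move=> P0 PS; elim/int_ind => // m Pm.
  by rewrite -addn1 PoszD; have [+ _] := PS m%:Z; apply.
by have [_] := PS (- m.+1%:Z); apply; have -> : - m.+1%:Z + 1 = - m%:Z by lia.
Qed.

(** A cylinder controls an orbit only at times [|k| <= N]; this induction never leaves that
    window. *)
Lemma int_bi_ind_le (N : nat) (P : int -> Prop) :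
  P 0 ->
  (forall k : int, `|k| <= N%:Z -> `|k + 1| <= N%:Z -> (P k <-> P (k + 1))) ->
  forall k : int, `|k| <= N%:Z -> P k.
Proof.
move=> P0 PS; elim/int_ind => // m Pm mN.
  have e : m%:Z + 1 = m.+1%:Z by lia.
  by have := PS m%:Z; rewrite e => -[||+ _]; try lia; apply; apply: Pm; lia.
have e : - m.+1%:Z + 1 = - m%:Z by lia.
by have := PS (- m.+1%:Z); rewrite e => -[||_]; try lia; apply; apply: Pm; lia.
Qed.

(** Nested intervals: step [m] keeps a closed quarter of the current interval, taken inside the half
    that does not contain [u m]. The supremum of the lower ends lies in all of them. *)
Lemma avoid_sequence (R : realType) (u : nat -> R) (c d : R) : c < d ->
  exists2 x, c < x < d & forall m, x <> u m.
Proof.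
pose step m (I : R * R) : R * R :=
  let w := I.2 - I.1 in
  if u m <= I.1 + w / 2 then (I.1 + w * 5 / 8, I.1 + w * 7 / 8)
  else (I.1 + w / 8, I.1 + w * 3 / 8).
pose I := fix I m : R * R := if m is m'.+1 then step m' (I m') else (c, d).
move=> cd.
have ltI m : (I m).1 < (I m).2.
  by elim: m => //= m IHm; rewrite /step; case: ifP => /= _; lra.
have stepI m : [/\ (I m).1 < (I m.+1).1, (I m.+1).2 < (I m).2 &
    u m < (I m.+1).1 \/ (I m.+1).2 < u m].
  have := ltI m; rewrite /= /step; case: (I m) => p q /= lt.
  case: (leP (u m) (p + (q - p) / 2)) => /= um.
    by split; [lra|lra|left; lra].
  by split; [lra|lra|right; lra].
have mono m p : (I m).1 <= (I (p + m)%N).1 /\ (I (p + m)%N).2 <= (I m).2.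
  elim: p => // p [h1 h2]; have [h3 h4 _] := stepI (p + m)%N.
  by rewrite addSn; split; lra.
have lowup m p : (I m).1 < (I p).2.
  have [/subnK e|/ltnW /subnK e] := leqP m p.
    by have [h _] := mono m (p - m)%N; rewrite e in h; apply: le_lt_trans h (ltI p).
  by have [_ h] := mono p (m - p)%N; rewrite e in h; apply: lt_le_trans (ltI m) h.
pose E : set R := fun r => exists m, r = (I m).1.
have [E0 ubE] : has_sup E.
  split; first by exists c, 0%N.
  by exists d => _ [m ->]; apply/ltW/(lowup m 0%N).
have low_x m : (I m).1 <= sup E by apply: (ub_le_sup ubE); exists m.
have x_up m : sup E <= (I m).2 by apply: (ge_sup E0) => _ [j ->]; apply/ltW.
exists (sup E) => [|m xm].
  have [h1 h2 _] := stepI 0%N; have := low_x 1%N; have := x_up 1%N.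
  by move: h1 h2; rewrite /=; lra.
have [_ _] := stepI m; have := low_x m.+1; have := x_up m.+1; lra.
Qed.

(** * Recurrence of intervals that move by translation *)

Section Drift.
Variables (R : realType) (f : R -> R).

(** The first [M + 1] terms fall into [M] boxes of length [1 / M < e]. *)
Lemma pigeonhole_close (u : nat -> R) (e : R) :
  0 < e -> (forall k, 0 <= u k < 1) ->
  exists k p : nat, (0 < p)%N /\ `|u (p + k)%N - u k| < e.
Proof.
move=> e0 u01; pose M := (Num.truncn e^-1).+1.
have Me : 1 < M%:R * e.
  have := truncnS_gt e^-1; rewrite -/M => h.
  by rewrite -ltr_pdivrMr // mul1r.
have M0 : 0 < M%:R :> R by rewrite ltr0n.
have Pu k : (Num.truncn (u k * M%:R) < M)%N.
  have /andP[u0 u1] := u01 k.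
  rewrite truncn_lt_nat; first by rewrite gtr_pMl.
  by rewrite mulr_ge0 // ltW.
pose g (i : 'I_M.+1) : 'I_M := Ordinal (Pu i).
have ninj : ~ injective g.
  by move=> /leq_card; rewrite !card_ord ltnn.
have [i [j [lt_ij gij]]] : exists i j : 'I_M.+1, (i < j)%N /\ g i = g j.
  apply: contra_notP ninj => noij i j gij.
  case: (ltngtP i j) => [lt_ij|lt_ij|/val_inj //]; exfalso; apply: noij.
    by exists i, j.
  by exists j, i.
exists i, (j - i)%N; rewrite subn_gt0 lt_ij subnK 1?ltnW //; split=> //.
have /= gij' : Num.truncn (u i * M%:R) = Num.truncn (u j * M%:R) by case: gij.
have b k : (Num.truncn (u k * M%:R))%:R <= u k * M%:R < (Num.truncn (u k * M%:R))%:R + 1.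
  have /andP[u0 u1] := u01 k.
  by rewrite natr1; apply: truncn_itv; rewrite mulr_ge0 // ltW.
have := b i; have := b j; rewrite gij' => bj bi.
have : `|u j - u i| * M%:R < 1.
  by rewrite -[X in _ * X](gtr0_norm M0) -normrM ltr_norml mulrBl; lra.
by move=> h; rewrite -(ltr_pM2r M0) (mulrC e); apply: lt_trans h Me.
Qed.

(* If [f ^ p] moves a point by [c] with [`|c| < e], then the interval and its
   image overlap, so [f ^ p] keeps translating by the same [c]; staying in
   [0, 1) then forces [c = 0]. *)
Lemma rigid_interval_periodic (u e : R) : 0 < e ->
  (forall k, 0 <= iter k f u < 1) ->
  (forall k t, 0 <= t < e -> iter k f (u + t) = iter k f u + t) ->
  exists k p : nat, (0 < p)%N /\ iter p f (iter k f u) = iter k f u.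
Proof.
move=> e0 u01 rigid.
have [k [p [p0 close]]] := pigeonhole_close e0 u01.
exists k, p; split=> //; move: close; rewrite iterD.
set v := iter k f u; set c := _ - v => ce.
have rigidv i j t : 0 <= t < e ->
    iter j f (iter i f v + t) = iter j f (iter i f v) + t.
  by move=> t0e; rewrite /v -!iterD -!rigid // -!iterD addnA.
have v01 i : 0 <= iter i f v < 1 by rewrite /v -iterD.
have drift j : iter (j * p) f v = v + c *+ j /\
    iter p f (iter (j * p) f v) = iter (j * p) f v + c.
  elim: j => [|j [IH1 IH2]]; first by rewrite mulr0n addr0 /c addrC subrK.
  have e1 : iter (j.+1 * p) f v = iter (j * p) f v + c.
    by rewrite mulSn iterD IH2.
  split; first by rewrite e1 IH1 -addrA -mulrSr.
  have [c0|c0] := leP 0 c.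
    rewrite {1}e1 rigidv; first by rewrite IH2 e1.
    by move: ce; rewrite ger0_norm // c0.
  (* Rigidity only allows shifts to the right, so for [c < 0] it is applied at the later point, from
     which the earlier one is reached by [- c]. *)
  have := @rigidv (j.+1 * p)%N p (- c).
  rewrite e1 addrK IH2; move: ce; rewrite ltr0_norm // => -> /(_ _); lra.
have [cz|cn] := eqVneq c 0; first by move: cz; rewrite /c; lra.
exfalso; pose M := (Num.truncn `|c|^-1).+1.
have c0 : 0 < `|c| by rewrite normr_gt0.
have : 1 < `|c *+ M|.
  rewrite normrMn -mulr_natr mulrC -ltr_pdivrMr // mul1r; exact: truncnS_gt.
have [e1 _] := drift M; have := v01 (M * p)%N; have := v01 0%N.
rewrite e1 /= => h1 h2; apply/negP; rewrite -leNgt ler_norml; lra.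
Qed.

End Drift.

(** * Both maps treated alike: inverses, integer powers, itineraries *)

Section TwoSided.
Variables (R : realType) (n : nat) (a : 'I_n -> R) (tau : {perm 'I_n}).
Hypotheses (a_gt0 : forall i, 0 < a i) (a_sum : \sum_(i < n) a i = 1).

(* The boolean [s] selects the map [T] on [0, 1) ([s = true]) or its dual [Tt]
   on (0, 1] ([s = false]). *)
Definition Jside s l x := if s then inJ a l x else inJt a l x.
Definition Tside s := if s then T a tau else Tt a tau.
Definition Tinvside s := if s then Tinv a tau else Ttinv a tau.
Definition Tpowside s := if s then Tpow a tau else Ttpow a tau.
Definition letterside s := if s then letter a else lettert a.
Definition itinside s := if s then itin a tau else itint a tau.
(** The translation that both maps perform on the interval of the letter [l]. *)
Definition tr l := btau a tau (tau l) - bpt a l.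

Lemma bpt0 : bpt a 0 = 0.
Proof. by rewrite bptE btau0. Qed.

Lemma bpt_n : bpt a n = 1.
Proof. by rewrite bptE btau_n. Qed.

Lemma bptS (l : 'I_n) : bpt a l.+1 = bpt a l + a l.
Proof. by have := btauS a 1%g l; rewrite !perm1 -!bptE. Qed.

Lemma bpt_inj i j : (i <= n)%N -> (j <= n)%N -> bpt a i = bpt a j -> i = j.
Proof. by rewrite !bptE; apply: btau_inj. Qed.

Lemma bpt_in01 i : (0 < i < n)%N -> 0 < bpt a i < 1.
Proof. by rewrite bptE; apply: btau_in01. Qed.

Lemma JsideE s l x : Jside s l x = Kside a 1%g s l x.
Proof. by case: s; rewrite /= /inJ /inJt /inK /inKt !bptE !perm1. Qed.

Lemma Jside_dom s l x : Jside s l x -> dom s x.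
Proof. by rewrite JsideE; apply: Kside_dom. Qed.

Lemma Jside_total s x : dom s x -> exists l, Jside s l x.
Proof.
by case/(Kside_total 1%g a_sum) => l Kl; exists l; rewrite JsideE.
Qed.

Lemma Jside_uniq s l l' x : Jside s l x -> Jside s l' x -> l = l'.
Proof. by rewrite !JsideE; apply: Kside_uniq. Qed.

Lemma Jside_interior s (l : 'I_n) x : bpt a l < x < bpt a l.+1 -> Jside s l x.
Proof. by case: s => /andP[h1 h2]; apply/andP; split; rewrite ?ltW. Qed.

Lemma Kside_tr s l x : Kside a tau s l (x + tr l) = Jside s l x.
Proof.
rewrite /Kside /Jside /inJ /inJt /inK /inKt btauS bptS /tr.
by case: s; apply/andP/andP => -[h1 h2]; split; lra.
Qed.

Lemma Kside_subtr s l y : Kside a tau s l y = Jside s l (y - tr l).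
Proof. by rewrite -Kside_tr subrK. Qed.

Lemma TsideE s l x : Jside s l x -> Tside s x = x + tr l.
Proof.
rewrite /tr addrCA addrC; case: s => Jl; rewrite /Tside /T /Tt.
  by case: pickP => [i /(@Jside_uniq true _ _ _ Jl)<-|/(_ l)]; rewrite ?[inJ _ _ _]Jl // addrC.
by case: pickP => [i /(@Jside_uniq false _ _ _ Jl)<-|/(_ l)]; rewrite ?[inJt _ _ _]Jl // addrC.
Qed.

Lemma lettersideE s l x : Jside s l x -> letterside s x = l.+1.
Proof.
case: s => Jl; rewrite /letterside /letter /lettert.
  by case: pickP => [i /(@Jside_uniq true _ _ _ Jl)<-|/(_ l)]; rewrite ?[inJ _ _ _]Jl.
by case: pickP => [i /(@Jside_uniq false _ _ _ Jl)<-|/(_ l)]; rewrite ?[inJt _ _ _]Jl.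
Qed.

Lemma TinvsideE s l y : Kside a tau s l y -> Tinvside s y = y - tr l.
Proof.
have uniq s' := @Kside_uniq _ _ _ tau a_gt0 s' l.
rewrite /tr opprB addrA (addrAC y); case: s => Kl; rewrite /Tinvside /Tinv /Ttinv.
  by case: pickP => [i /(uniq true _ _ Kl)<-|/(_ l)]; rewrite ?[inK _ _ _ _]Kl.
by case: pickP => [i /(uniq false _ _ Kl)<-|/(_ l)]; rewrite ?[inKt _ _ _ _]Kl.
Qed.

Lemma Tside_dom s x : dom s x -> dom s (Tside s x).
Proof.
case/Jside_total => l Jl; rewrite (TsideE Jl).
by move: Jl; rewrite -Kside_tr; apply: Kside_dom.
Qed.

Lemma Tinvside_dom s x : dom s x -> dom s (Tinvside s x).
Proof.
case/(Kside_total tau a_sum) => l Kl; rewrite (TinvsideE Kl).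
by move: Kl; rewrite Kside_subtr; apply: Jside_dom.
Qed.

Lemma TsideK s x : dom s x -> Tinvside s (Tside s x) = x.
Proof.
case/Jside_total => l Jl; rewrite (TsideE Jl).
by rewrite -Kside_tr in Jl; rewrite (TinvsideE Jl) addrK.
Qed.

Lemma TinvsideK s x : dom s x -> Tside s (Tinvside s x) = x.
Proof.
case/(Kside_total tau a_sum) => l Kl; rewrite (TinvsideE Kl).
by rewrite Kside_subtr in Kl; rewrite (TsideE Kl) subrK.
Qed.

Lemma Tside_inj s x y : dom s x -> dom s y -> Tside s x = Tside s y -> x = y.
Proof. by move=> /TsideK {2}<- /TsideK {2}<- ->. Qed.

Lemma Tpowside0 s x : Tpowside s 0 x = x.
Proof. by case: s. Qed.

Lemma Tpowside_nat s (m : nat) x : Tpowside s m x = iter m (Tside s) x.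
Proof. by case: s. Qed.

Lemma Tpowside_negz s (m : nat) x : Tpowside s (Negz m) x = iter m.+1 (Tinvside s) x.
Proof. by case: s. Qed.

Lemma Tpowside_dom s k x : dom s x -> dom s (Tpowside s k x).
Proof.
move=> domx; case: k => m; rewrite ?Tpowside_nat ?Tpowside_negz.
  by elim: m => //= m IHm; apply: Tside_dom.
by elim: m.+1 => //= m' IHm; apply: Tinvside_dom.
Qed.

Lemma Tpowside_succ s k x : dom s x -> Tpowside s (k + 1) x = Tside s (Tpowside s k x).
Proof.
move=> domx; case: k => [m|[|m]].
- by rewrite (_ : Posz m + 1 = m.+1%:Z) ?Tpowside_nat //; lia.
- by rewrite Tpowside_negz /= TinvsideK ?Tpowside0.
- have -> : Negz m.+1 + 1 = Negz m by lia.
  by rewrite !Tpowside_negz [in RHS]iterS TinvsideK // -Tpowside_negz Tpowside_dom.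
Qed.

(** Backwards this is injectivity of the map. It yields additivity of the powers without a
    discussion of signs. *)
Lemma Tpowside_unique s (y : int -> R) :
  (forall k, dom s (y k)) -> (forall k, y (k + 1) = Tside s (y k)) ->
  forall k, y k = Tpowside s k (y 0).
Proof.
move=> domy yS; elim/int_bi_ind => [|k]; first by rewrite Tpowside0.
rewrite yS Tpowside_succ //; split=> [-> //|].
by apply: Tside_inj; rewrite ?Tpowside_dom.
Qed.

Lemma Tpowside_add s k m x : dom s x ->
  Tpowside s (k + m) x = Tpowside s k (Tpowside s m x).
Proof.
move=> domx; rewrite (@Tpowside_unique s (fun i => Tpowside s (i + m) x)) ?add0r //.
  by move=> i; apply: Tpowside_dom.
by move=> i; rewrite addrAC Tpowside_succ.
Qed.

Lemma Tpowside_inj s k x y : dom s x -> dom s y ->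
  Tpowside s k x = Tpowside s k y -> x = y.
Proof.
move=> domx domy e; rewrite -(Tpowside0 s x) -(Tpowside0 s y) -(addNr k).
by rewrite !Tpowside_add // e.
Qed.

Lemma itinsideE s x k : itinside s x k = letterside s (Tpowside s k x).
Proof. by case: s. Qed.

Lemma itinside_Tpow s x m : dom s x -> itinside s (Tpowside s m x) = shiftk m (itinside s x).
Proof.
by move=> domx; apply/funext => k; rewrite /shiftk !itinsideE Tpowside_add.
Qed.

(* Both the itineraries of [T] and those of [Tt] are coded by points moving in
   the closed intervals [b_l, b_{l+1}]. *)
Definition closed_orbit (alpha : int -> nat) (x : int -> R) :=
  forall k, exists l : 'I_n,
    [/\ alpha k = l.+1, bpt a l <= x k <= bpt a l.+1 & x (k + 1) = x k + tr l].

Lemma closed_orbit_itin s x : dom s x ->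
  closed_orbit (itinside s x) (Tpowside s ^~ x).
Proof.
move=> domx k; have [l Jl] := Jside_total (Tpowside_dom k domx).
exists l; rewrite itinsideE Tpowside_succ // (TsideE Jl) (lettersideE Jl); split=> //.
by move: Jl; case: s {domx} => /andP[h1 h2]; rewrite ?h1 ?h2 ?andbT ltW.
Qed.

Lemma closed_orbit_shift alpha x m : closed_orbit alpha x ->
  closed_orbit (shiftk m alpha) (fun k => x (k + m)).
Proof.
move=> ax k; have [l [al Jl xS]] := ax (k + m).
by exists l; split=> //; rewrite addrAC.
Qed.

Lemma orbit_itin s (x : int -> R) (l : int -> 'I_n) :
  (forall k, Jside s (l k) (x k)) -> (forall k, x (k + 1) = x k + tr (l k)) ->
  forall k, itinside s (x 0) k = (l k).+1.
Proof.
move=> Jx xS k; rewrite itinsideE -(Tpowside_unique (y := x)).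
- exact: lettersideE.
- by move=> i; apply: Jside_dom (Jx i).
- by move=> i; rewrite xS (TsideE (Jx i)).
Qed.

Lemma Jside_bpt (l : 'I_n) : Jside true l (bpt a l).
Proof. by rewrite /= /inJ lexx bptS ltrDl a_gt0. Qed.

Lemma Jside_bptS (l : 'I_n) : Jside false l (bpt a l.+1).
Proof. by rewrite /= /inJt lexx bptS ltrDl a_gt0. Qed.

Lemma Tside_bpt (l : 'I_n) : Tside true (bpt a l) = btau a tau (tau l).
Proof. by rewrite (TsideE (Jside_bpt l)) addrC subrK. Qed.

Lemma Tside_bptS (l : 'I_n) : Tside false (bpt a l.+1) = btau a tau (tau l).+1.
Proof. by rewrite (TsideE (Jside_bptS l)) btauS bptS /tr; ring. Qed.

(** * The Keane Condition excludes periodic points *)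

Hypothesis tau0_neq0 : forall l : 'I_n, l = 0%N :> nat -> tau l != 0%N :> nat.
Hypothesis keaneT : keane a tau.
Hypothesis n_ge2 : (2 <= n)%N.

Lemma keane_int (k : int) i j : (0 < i < n)%N -> (0 < j < n)%N -> 0 < k ->
  Tpowside true k (bpt a i) <> bpt a j.
Proof.
by case: k => // m hi hj m0; apply: keaneT => //; [exists i|exists j].
Qed.

(** The letter placed first by [tau] is not the first letter, which is the case [j = 1] of
    irreducibility; so 0 lies in [T D]. *)
Lemma zero_from_D : exists2 q : 'I_n, (0 < q)%N &
  tau q = 0%N :> nat /\ Tside true (bpt a q) = 0.
Proof.
have n0 : (0 < n)%N by apply: ltnW.
have tauq : tau ((tau^-1)%g (Ordinal n0)) = 0%N :> nat by rewrite permKV.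
exists ((tau^-1)%g (Ordinal n0)); last by rewrite Tside_bpt tauq btau0.
rewrite lt0n; apply/negP => /eqP /tau0_neq0; by rewrite tauq.
Qed.

Lemma dom_bpt s i : (0 < i < n)%N -> dom s (bpt a i).
Proof. by move/bpt_in01 => /andP[h1 h2]; case: s; rewrite /dom; lra. Qed.

Lemma dom_btau s i : (0 < i < n)%N -> dom s (btau a tau i).
Proof.
by move/(btau_in01 tau a_gt0 a_sum) => /andP[h1 h2]; case: s; rewrite /dom; lra.
Qed.

(** The point is the image of a left endpoint. That endpoint is in [D], or it is 0 and one more step
    back reaches [D]. *)
Lemma btau_from_D i : (0 < i < n)%N ->
  exists (m j : nat), [/\ (0 < m)%N, (0 < j < n)%N &
    btau a tau i = Tpowside true m (bpt a j)].
Proof.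
move=> /andP[i0 lt_in]; pose p := (tau^-1)%g (Ordinal lt_in).
have Tp : Tside true (bpt a p) = btau a tau i by rewrite Tside_bpt permKV.
case: (posnP p) => [pz|p0].
  have [q q0 [_ Tq]] := zero_from_D; exists 2%N, q.
  by rewrite q0 ltn_ord -Tp pz bpt0 -Tq.
by exists 1%N, p; rewrite p0 ltn_ord -Tp.
Qed.

(* Slide a periodic point to the left until its orbit hits a left endpoint. *)
Lemma no_periodic_point x p : dom true x -> (0 < p)%N ->
  iter p (Tside true) x <> x.
Proof.
move=> domx p0 per; set f := Tside true.
have /choice[l Jl] : forall k : nat, exists l, Jside true l (iter k f x).
  by move=> k; apply: Jside_total; rewrite -Tpowside_nat Tpowside_dom.
pose gap (k : 'I_p) := iter k f x - bpt a (l k).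
case: (@Order.TotalTheory.arg_minP _ _ _ (Ordinal p0) xpredT gap isT) => k0 _ min_k0.
set d := gap k0 in min_k0.
have d0 : 0 <= d by rewrite subr_ge0; have /andP[] := Jl k0.
(* The smallest gap [d] leaves every point of the orbit in its interval, so the whole orbit slides
   rigidly by [d]. *)
have slide k : (k <= p)%N -> iter k f (x - d) = iter k f x - d.
  elim: k => //= k IHk lt_kp; rewrite IHk ?(ltnW lt_kp) // /f (TsideE (Jl k)).
  rewrite (TsideE (l := l k)); first by rewrite addrAC.
  have := min_k0 (Ordinal lt_kp) isT; have /andP[h1 h2] := Jl k.
  by rewrite /gap /= => h3; apply/andP; split; lra.
pose y := iter k0 f (x - d).
have yE : y = bpt a (l k0) by rewrite /y slide 1?ltnW // subKr.
have pery : iter p f y = y by rewrite /y -iterD addnC iterD slide // per.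
have domy : dom true y by rewrite yE; apply: Jside_dom (Jside_bpt _).
have noD j : (0 < j < n)%N -> iter p f (bpt a j) <> bpt a j.
  by move=> hj; have := @keane_int p j j hj hj; rewrite Tpowside_nat; apply.
case: (posnP (l k0)) => [lz|l0]; last first.
  by apply: (noD (l k0)); rewrite ?l0 ?ltn_ord // -yE.
(* Here 0 itself is periodic. As [T b_q = 0], injectivity makes [b_q] periodic as well. *)
have [q q0 [_ Tq]] := zero_from_D; apply: (noD q); first by rewrite q0 ltn_ord.
have dq : dom true (bpt a q) by apply: Jside_dom (Jside_bpt _).
apply: (@Tside_inj true) => //; first by rewrite -Tpowside_nat Tpowside_dom.
by rewrite Tq -[Tside true _]/(iter p.+1 f (bpt a q)) iterSr [f _]Tq -bpt0 -lz -yE.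
Qed.

(** * One-sided sequences of letters determine the point *)

Lemma closed_orbit_step alpha beta x y k :
  closed_orbit alpha x -> closed_orbit beta y -> alpha k = beta k ->
  exists l : 'I_n, [/\ alpha k = l.+1, beta k = l.+1,
    bpt a l <= x k <= bpt a l.+1, bpt a l <= y k <= bpt a l.+1 &
    x (k + 1) = x k + tr l /\ y (k + 1) = y k + tr l].
Proof.
move=> ax by_ eq_ab; have [l [al xl xS]] := ax k; have [l' [bl yl yS]] := by_ k.
have ll' : l' = l by apply/val_inj/eq_add_S; rewrite -al -bl eq_ab.
by exists l; move: bl yl yS; rewrite ll'.
Qed.

(** Equal letters mean equal translations, so the gap between the orbits is constant. Points
    strictly between them are interior to the common interval and follow [T] rigidly for ever. *)
Lemma forward_gap alpha beta x y : closed_orbit alpha x -> closed_orbit beta y ->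
  (forall k, 0 <= k -> alpha k = beta k) -> ~ (x 0 < y 0).
Proof.
move=> ax by_ eq_ab ltxy; pose f := Tside true.
have gap (k : nat) : y k - x k = y 0 - x 0.
  elim: k => // k IHk; have -> : Posz k.+1 = k%:Z + 1 by lia.
  have [//|l [_ _ _ _ [-> ->]]] := closed_orbit_step ax by_ (eq_ab k _).
  by rewrite -IHk; ring.
have inner (k : nat) t : 0 < t < y 0 - x 0 ->
    exists2 l, Jside true l (x k + t) & x k.+1 = x k + tr l.
  move=> t0; have [//|l [_ _ xl yl [xS _]]] := closed_orbit_step ax by_ (eq_ab k _).
  exists l; last by rewrite -xS; congr x; lia.
  by apply: Jside_interior; have := gap k; lra.
have shadow t (k : nat) : 0 < t < y 0 - x 0 -> iter k f (x 0 + t) = x k + t.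
  move=> t0; elim: k => //= k ->; have [l Jl ->] := inner k t t0.
  by rewrite /f (TsideE Jl) addrAC.
(* The base point is the midpoint, since the ends of the gap may sit on breakpoints and follow [Tt]
   instead of [T]. *)
pose e := (y 0 - x 0) / 2; have e0 : 0 < e by rewrite /e; lra.
have ue t : 0 <= t < e -> 0 < e + t < y 0 - x 0 by rewrite /e; lra.
have ue0 : 0 < e < y 0 - x 0 by rewrite /e; lra.
have dom_u (k : nat) : dom true (iter k f (x 0 + e)).
  by rewrite shadow //; have [l Jl _] := inner k e ue0; apply: Jside_dom Jl.
have [|k [p [p0]]] := rigid_interval_periodic (f := f) (u := x 0 + e) e0 dom_u.
  by move=> k t te; rewrite -addrA !shadow ?addrA ?ue.
exact: no_periodic_point.
Qed.

Lemma backward_gap alpha beta x y : closed_orbit alpha x -> closed_orbit beta y ->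
  (forall k, k < 0 -> alpha k = beta k) -> ~ (x 0 < y 0).
Proof.
move=> ax by_ eq_ab ltxy; pose f := Tinvside true.
have eq_neg (k : nat) : alpha (- k.+1%:Z) = beta (- k.+1%:Z) by apply: eq_ab; lia.
have negS (k : nat) : - k.+1%:Z + 1 = - k%:Z by lia.
have gap (k : nat) : y (- k%:Z) - x (- k%:Z) = y 0 - x 0.
  elim: k => [|k <-]; first by rewrite oppr0.
  have [l [_ _ _ _ []]] := closed_orbit_step ax by_ (eq_neg k).
  by rewrite negS => -> ->; ring.
have inner (k : nat) t : 0 < t < y 0 - x 0 ->
    exists2 l, Jside true l (x (- k.+1%:Z) + t) & x (- k%:Z) = x (- k.+1%:Z) + tr l.
  move=> t0; have [l [_ _ xl yl [xS _]]] := closed_orbit_step ax by_ (eq_neg k).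
  exists l; last by rewrite -xS negS.
  by apply: Jside_interior; have := gap k.+1; lra.
have shadow t (k : nat) : 0 < t < y 0 - x 0 -> iter k f (x 0 + t) = x (- k%:Z) + t.
  move=> t0; elim: k => [|k]; first by rewrite oppr0.
  rewrite iterS => ->; have [l Jl ->] := inner k t t0.
  rewrite addrAC -(TsideE Jl); apply: TsideK; exact: Jside_dom Jl.
pose e := (y 0 - x 0) / 2; have e0 : 0 < e by rewrite /e; lra.
have ue t : 0 <= t < e -> 0 < e + t < y 0 - x 0 by rewrite /e; lra.
have ue0 : 0 < e < y 0 - x 0 by rewrite /e; lra.
have [l0 J0 x0S] := inner 0%N e ue0.
have dom_u (k : nat) : dom true (iter k f (x 0 + e)).
  (* [inner] places the points at negative times only; the point at time 0 is the [T]-image of the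
     one at time -1. *)
  case: k => [|k]; last first.
    by rewrite shadow //; have [l Jl _] := inner k e ue0; apply: Jside_dom Jl.
  rewrite /= -[x 0](congr1 x (oppr0 _)) x0S addrAC -(TsideE J0).
  by apply: (@Tside_dom true); apply: Jside_dom J0.
have [|k [p [p0]]] := rigid_interval_periodic (f := f) (u := x 0 + e) e0 dom_u.
  by move=> k t te; rewrite -addrA !shadow ?addrA ?ue.
set v := iter k f _ => per; apply: (no_periodic_point (dom_u k) p0); rewrite -/v.
(* A return under the inverse map is undone by as many steps of [T], hence is a return under [T]. *)
have : forall m, iter m (Tside true) (iter m f v) = v.
  elim=> // m IHm; rewrite iterSr iterS TinvsideK //.
  by rewrite /v -iterD.
by move/(_ p); rewrite per.
Qed.

Lemma forward_determines alpha beta x y :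
  closed_orbit alpha x -> closed_orbit beta y ->
  (forall k, 0 <= k -> alpha k = beta k) -> x 0 = y 0.
Proof.
move=> ax by_ eq_ab; case: (ltgtP (x 0) (y 0)) => // lt; exfalso.
  exact: (forward_gap ax by_ eq_ab).
by apply: (forward_gap by_ ax _ lt) => k /eq_ab.
Qed.

Lemma backward_determines alpha beta x y :
  closed_orbit alpha x -> closed_orbit beta y ->
  (forall k, k < 0 -> alpha k = beta k) -> x 0 = y 0.
Proof.
move=> ax by_ eq_ab; case: (ltgtP (x 0) (y 0)) => // lt; exfalso.
  exact: (backward_gap ax by_ eq_ab).
by apply: (backward_gap by_ ax _ lt) => k /eq_ab.
Qed.

(** * Points of [X] are itineraries *)

Lemma letterside_Jside s l x : dom s x -> letterside s x = l.+1 ->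
  exists2 l' : 'I_n, l = l' & Jside s l' x.
Proof.
by case/Jside_total => l' Jl'; rewrite (lettersideE Jl') => -[<-]; exists l'.
Qed.

Lemma finite_shadow s (x : int -> R) (l : int -> 'I_n) (N : nat) :
  (forall k : int, `|k| <= N%:Z -> Jside s (l k) (x k)) ->
  (forall k, x (k + 1) = x k + tr (l k)) ->
  forall k : int, `|k| <= N%:Z -> Tpowside s k (x 0) = x k.
Proof.
move=> Jx xS.
have dom0 : dom s (x 0) by apply: (Jside_dom (Jx 0 _)).
apply: int_bi_ind_le => [|k kN kN']; first by rewrite Tpowside0.
rewrite Tpowside_succ // xS -(TsideE (Jx k kN)); split=> [-> //|].
apply: Tside_inj; first exact: Tpowside_dom.
exact: Jside_dom (Jx k kN).
Qed.

(** The position at time [k], relative to time 0, of an orbit with letters [l]. Since [Negz m] is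
    [-(m + 1)], its sum has [m + 1] terms. *)
Definition displacement (l : int -> 'I_n) (k : int) : R :=
  match k with
  | Posz m => \sum_(i < m) tr (l i)
  | Negz m => - \sum_(i < m.+1) tr (l (Negz i))
  end.

Lemma displacementS l k : displacement l (k + 1) = displacement l k + tr (l k).
Proof.
case: k => [m|[|m]].
- by rewrite (_ : Posz m + 1 = m.+1) ?[LHS]big_ord_recr //; lia.
- by rewrite /= big_ord0 big_ord1 addNr.
- have -> : Negz m.+1 + 1 = Negz m by lia.
  by rewrite /= [in RHS]big_ord_recr opprD subrK.
Qed.

Lemma displacement0 l : displacement l 0 = 0.
Proof. by rewrite /= big_ord0. Qed.

Lemma regular_dom x : regular a tau x -> dom true x.
Proof.
case=> /andP[x0 x1] [_ [/eqP xn1 _]].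
by rewrite /dom x0 lt_neqAle xn1 x1.
Qed.

(* The sup [x] of the lower ends of the cylinders of [alpha] lies in every closed
   cylinder; as lower ends lie strictly below upper ends, if [x] is the upper end
   of one cylinder then it is the lower end of none, and [alpha] codes the
   [Tt]-orbit of [x]. *)
Lemma inX_itin alpha : inX a tau alpha ->
  exists s x, dom s x /\ alpha = itinside s x.
Proof.
move=> Xa.
have /choice[l al] : forall k, exists l : 'I_n, alpha k = l.+1.
  move=> k; have [x [/regular_dom domx ax]] := Xa `|k|%N.
  have [l Jl] := Jside_total (Tpowside_dom k domx); exists l.
  by rewrite ax -?(lettersideE Jl) -?itinsideE //; lia.
pose low k := bpt a (l k) - displacement l k.
pose up k := bpt a (l k).+1 - displacement l k.
have cyl (N : nat) : exists x, forall k : int, `|k| <= N%:Z -> low k <= x < up k.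
  have [x [/regular_dom domx ax]] := Xa N; exists x.
  have Jx k : `|k| <= N%:Z -> Jside true (l k) (Tpowside true k x).
    move=> /ax; rewrite al => /esym; rewrite -[itin _ _]/(itinside true) itinsideE.
    by case/(letterside_Jside (Tpowside_dom k domx)) => l' /val_inj ->.
  have xk : forall k : int, `|k| <= N%:Z -> Tpowside true k x = x + displacement l k.
    apply: int_bi_ind_le => [|k kN kN'].
      by rewrite Tpowside0 displacement0 addr0.
    rewrite Tpowside_succ // displacementS (TsideE (Jx k kN)).
    by split; lra.
  by move=> k kN; have := Jx k kN; rewrite xk // /= /inJ /low /up; lra.
have low_up j k : low j < up k.
  have [x cx] := cyl (maxn `|j| `|k|).
  have /andP[h1 _] : low j <= x < up j by apply: cx; lia.
  have /andP[_ h2] : low k <= x < up k by apply: cx; lia.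
  exact: le_lt_trans h1 h2.
pose E : set R := fun r => exists k, r = low k.
pose x := sup E.
have [E0 ubE] : has_sup E.
  split; first by exists (low 0), 0.
  by exists (up 0) => _ [k ->]; apply/ltW.
have low_x k : low k <= x by apply: (ub_le_sup ubE); exists k.
have x_up k : x <= up k by apply: (ge_sup E0) => _ [j ->]; apply/ltW.
have orb s : (forall k, Jside s (l k) (x + displacement l k)) ->
    dom s x /\ alpha = itinside s x.
  move=> Jx; split.
    by rewrite -[x]addr0 -(displacement0 l); apply: Jside_dom (Jx 0).
  apply/funext => k; rewrite al -[x]addr0 -(displacement0 l).
  rewrite (orbit_itin (x := fun i => x + displacement l i) Jx) // => i.
  by rewrite displacementS addrA.
have [x_lt|/existsNP[k0 /negP]] := pselect (forall k, x < up k).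
  exists true, x; apply: orb => k /=; have := low_x k; have := x_lt k.
  by rewrite /inJ /low /up; lra.
rewrite -leNgt => up_x; exists false, x; apply: orb => k /=.
have := low_up k k0; have := x_up k; rewrite /inJt /low /up.
by move: up_x; rewrite /up; lra.
Qed.

(** * Itineraries of both maps belong to [X] *)

Lemma uniform_room (g : int -> R) (N : nat) : (forall k, 0 < g k) ->
  exists2 e, 0 < e & forall k : int, `|k| <= N%:Z -> e <= g k.
Proof.
move=> g0; elim: N => [|N [e e0 He]].
  by exists (g 0) => // k k0; have -> : k = 0 by lia.
exists (Num.min e (Num.min (g N.+1) (g (- N.+1%:Z)))); first by rewrite !lt_min !g0 e0.
move=> k kN; rewrite !ge_min.
have [/He->//|[->|->]] : `|k| <= N%:Z \/ k = N.+1 \/ k = - N.+1%:Z by lia.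
  by rewrite lexx orbT.
by rewrite lexx !orbT.
Qed.

Lemma regular_dense c d : 0 <= c -> c < d -> d <= 1 ->
  exists2 x, c < x < d & regular a tau x.
Proof.
move=> c0 cd d1.
(* An enumeration of all pairs of a time and an index; codes of no pair get the default 0. *)
pose u m := if @unpickle (int * nat)%type m is Some ki
  then Tpowside true ki.1 (bpt a ki.2) else 0.
have [x xcd xu] := avoid_sequence u cd.
exists x => //; split; first by apply/andP; split; lra.
split; first by lra.
split; first by lra.
move=> k _ [i [_ ->]] xE; apply: (xu (pickle (k, i))).
by rewrite /u pickleK.
Qed.

(** During a finite window the orbit keeps a distance [e] from the open ends of its intervals.
    Moving [x] towards that side by less than [e], to a regular point, puts the orbit inside the
    same intervals, where [T] and [Tt] agree. *)
Lemma itin_inX s x : dom s x -> inX a tau (itinside s x).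
Proof.
move=> domx N.
have /choice[l Jl] : forall k, exists l, Jside s l (Tpowside s k x).
  by move=> k; apply: Jside_total; apply: Tpowside_dom.
pose room k := if s then bpt a (l k).+1 - Tpowside s k x
               else Tpowside s k x - bpt a (l k).
have room0 k : 0 < room k.
  by have := Jl k; rewrite /room; case: (s) => /andP[]; lra.
have [e e0 He] := uniform_room N room0.
have [t te [z0 [z1 reg]]] : exists2 t, (if s then 0 < t < e else - e < t < 0) &
    [/\ 0 <= x + t, x + t <= 1 & regular a tau (x + t)].
  have [c [d [c0 cd d1 Hcd]]] : exists c d, [/\ 0 <= c, c < d, d <= 1 &
      forall z, c < z < d -> if s then 0 < z - x < e else - e < z - x < 0].
    case: (s) domx => /= /andP[x0 x1].
      exists x, (Num.min (x + e) 1); rewrite lt_min ge_min lexx orbT x1 x0.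
      rewrite ltrDl e0; split=> // z; rewrite lt_min; lra.
    exists (Num.max (x - e) 0), x; rewrite gt_max le_max lexx orbT x1 x0.
    rewrite gtrBl e0; split=> // z; rewrite gt_max; lra.
  have [z zcd reg] := regular_dense c0 cd d1.
  exists (z - x); first exact: Hcd.
  by rewrite addrC subrK; split=> //; lra.
exists (x + t); split=> // k kN.
have Jt (i : int) : `|i| <= N%:Z -> Jside true (l i) (Tpowside s i x + t).
  move=> /He; have := Jl i; rewrite /room => Ji ie; apply: Jside_interior.
  by move: te Ji ie; case: (s) => /= te /andP[h1 h2] ie; lra.
have := finite_shadow (x := fun i => Tpowside s i x + t) Jt _ kN.
rewrite Tpowside0 -[itin _ _]/(itinside true) !itinsideE => ->.
  by rewrite (lettersideE (Jl k)) (lettersideE (Jt k kN)).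
by move=> i; rewrite Tpowside_succ // (TsideE (Jl i)) addrAC.
Qed.

(** * Where the two orbits of one point separate *)

Lemma Tpowside_pred s k x : dom s x -> Tinvside s (Tpowside s (k + 1) x) = Tpowside s k x.
Proof. by move=> domx; rewrite Tpowside_succ // TsideK // Tpowside_dom. Qed.

Lemma dom_both (w : R) : dom true w -> dom false w -> 0 < w < 1.
Proof. by rewrite /dom; lra. Qed.

(** Off [D] a point is interior to its interval, so both maps act alike on it. [interior_K] is the
    counterpart for the inverse maps off [D^tau]. *)
Lemma interior_J (w : R) : 0 < w < 1 -> (forall i, (0 < i < n)%N -> w <> bpt a i) ->
  exists l : 'I_n, bpt a l < w < bpt a l.+1.
Proof.
move=> w01 wD; have [|l /andP[lw wl]] := @Jside_total true w; first by rewrite /dom; lra.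
exists l; rewrite wl andbT lt_neqAle lw andbT; apply/eqP => lE.
case: (posnP l) => [lz|l0]; first by move: w01; rewrite -lE lz bpt0 ltxx.
by apply: (wD l) => //; rewrite l0 ltn_ord.
Qed.

Lemma interior_K (w : R) : 0 < w < 1 -> (forall i, (0 < i < n)%N -> w <> btau a tau i) ->
  exists l : 'I_n, bpt a l < w - tr l < bpt a l.+1.
Proof.
move=> w01 wD; have [|l /andP[lw wl]] := @Kside_total _ _ _ tau a_sum true w.
  by rewrite /dom; lra.
have lt_lw : btau a tau (tau l) < w.
  rewrite lt_neqAle lw andbT; apply/eqP => lE.
  case: (posnP (tau l)) => [lz|l0]; first by move: w01; rewrite -lE lz btau0 ltxx.
  by apply: (wD (tau l)) => //; rewrite l0 ltn_ord.
by exists l; move: wl; rewrite btauS bptS /tr; lra.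
Qed.

Lemma itinside_back s k x w : dom s x -> Tpowside s k x = w ->
  itinside s x = shiftk (- k) (itinside s w).
Proof.
by move=> domx <-; rewrite -itinside_Tpow ?Tpowside_dom // -Tpowside_add // addNr Tpowside0.
Qed.

(** Let [-(m + 1)] be the last time at which the letters differ. The orbits still coincide at time
    [-m], and off [D^tau] that common point would have a common preimage with a common letter. *)
Lemma first_backward_split z : dom true z -> dom false z ->
  (forall k, 0 <= k -> itinside true z k = itinside false z k) ->
  itinside true z <> itinside false z ->
  exists i k, (0 < i < n)%N /\ forall s, Tpowside s k z = btau a tau i.
Proof.
move=> dt df eq_fwd neq.
pose differ m := itinside true z (- m.+1%:Z) != itinside false z (- m.+1%:Z).
have ex : exists m, differ m.
  apply/not_existsP => all_eq; apply: neq; apply/funext => k.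
  have [/eq_fwd//|k0] := leP 0 k; have := all_eq `|k|%N.-1.
  by rewrite /differ => /negP/negPn/eqP; have -> : - (`|k|%N.-1).+1%:Z = k by lia.
case: (ex_minnP ex) => m dm min_m.
have negS (k : nat) : - k.+1%:Z + 1 = - k%:Z by lia.
have paired (j : nat) : (j <= m)%N -> Tpowside true (- j%:Z) z = Tpowside false (- j%:Z) z.
  elim: j => [|j IHj lt_jm]; first by rewrite oppr0 !Tpowside0.
  have eq_j : itinside true z (- j.+1%:Z) = itinside false z (- j.+1%:Z).
    by apply/eqP/negPn/negP => /min_m; rewrite leqNgt lt_jm.
  have [l [_ _ _ _ []]] :=
    closed_orbit_step (closed_orbit_itin dt) (closed_orbit_itin df) eq_j.
  by rewrite negS IHj ?(ltnW lt_jm) // => -> /addIr.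
have w01 : 0 < Tpowside true (- m%:Z) z < 1.
  by apply: dom_both; [|rewrite paired //]; apply: Tpowside_dom.
have [[i [hi wE]]|noi] := pselect (exists i, (0 < i < n)%N /\
    Tpowside true (- m%:Z) z = btau a tau i).
  by exists i, (- m%:Z); split=> // -[] //; rewrite -paired.
exfalso; have [|l wl] := interior_K w01.
  by move=> i hi wE; apply: noi; exists i.
move/negP: dm; apply; apply/eqP; rewrite !itinsideE.
have pull s : dom s z -> Tpowside s (- m%:Z) z = Tpowside true (- m%:Z) z ->
    letterside s (Tpowside s (- m.+1%:Z) z) = l.+1.
  move=> domz e; apply: lettersideE; rewrite -Tpowside_pred // negS e.
  have Jl := Jside_interior s wl; rewrite (TinvsideE (l := l)) //.
  by rewrite Kside_subtr.
by rewrite !pull // paired.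
Qed.

(** The letter at time [m] is read from the position at time [m] itself, so the first disagreement
    occurs at a common point of [D]. *)
Lemma first_forward_split z : dom true z -> dom false z ->
  (forall k, k < 0 -> itinside true z k = itinside false z k) ->
  itinside true z <> itinside false z ->
  exists i k, (0 < i < n)%N /\ forall s, Tpowside s k z = bpt a i.
Proof.
move=> dt df eq_bwd neq.
pose differ (m : nat) := itinside true z m != itinside false z m.
have ex : exists m, differ m.
  apply/not_existsP => all_eq; apply: neq; apply/funext => k.
  have [k0|/eq_bwd//] := leP 0 k; have := all_eq `|k|%N.
  by rewrite /differ => /negP/negPn/eqP; rewrite gez0_abs.
case: (ex_minnP ex) => m dm min_m.
have posS (k : nat) : k%:Z + 1 = k.+1%:Z by lia.
have paired (j : nat) : (j <= m)%N -> Tpowside true j z = Tpowside false j z.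
  elim: j => [|j IHj lt_jm]; first by rewrite !Tpowside0.
  have eq_j : itinside true z j = itinside false z j.
    by apply/eqP/negPn/negP => /min_m; rewrite leqNgt lt_jm.
  have [l [_ _ _ _ []]] :=
    closed_orbit_step (closed_orbit_itin dt) (closed_orbit_itin df) eq_j.
  by rewrite posS IHj ?(ltnW lt_jm) // => -> ->.
have w01 : 0 < Tpowside true m z < 1.
  by apply: dom_both; [|rewrite paired //]; apply: Tpowside_dom.
have [[i [hi wE]]|noi] := pselect (exists i, (0 < i < n)%N /\
    Tpowside true m z = bpt a i).
  by exists i, m; split=> // -[] //; rewrite -paired.
exfalso; have [|l wl] := interior_J w01.
  by move=> i hi wE; apply: noi; exists i.
move/negP: dm; apply; apply/eqP; rewrite !itinsideE -paired //.
by rewrite !(lettersideE (Jside_interior _ wl)).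
Qed.

(** The point is [T^m d] with [d] in [D] and [m > 0], so by Keane its forward orbit, time 0
    included, avoids [D] and both maps agree along it. *)
Lemma btau_forward_paired i : (0 < i < n)%N -> forall k, 0 <= k ->
  itinside true (btau a tau i) k = itinside false (btau a tau i) k.
Proof.
move=> hi k k0; set w := btau a tau i.
have dw s : dom s w by apply: dom_btau.
have [m' [j [m0 hj wE]]] := btau_from_D hi.
have inner (m : nat) : Tpowside true m w = Tpowside false m w ->
    exists l : 'I_n, bpt a l < Tpowside true m w < bpt a l.+1.
  move=> e; apply: interior_J; first by apply: dom_both; [|rewrite e]; apply: Tpowside_dom.
  move=> i' hi'; rewrite /w wE -Tpowside_add; last by apply: dom_bpt.
  by apply: keane_int => //; lia.
have paired (m : nat) : Tpowside true m w = Tpowside false m w.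
  elim: m => [|m IHm]; first by rewrite !Tpowside0.
  have [l Jl] := inner m IHm; have -> : Posz m.+1 = m%:Z + 1 by lia.
  by rewrite !Tpowside_succ // -IHm !(TsideE (Jside_interior _ Jl)).
case: k k0 => // m _; have [l Jl] := inner m (paired m).
by rewrite !itinsideE -paired !(lettersideE (Jside_interior _ Jl)).
Qed.

(** A visit of the backward orbit to [D^tau] would exhibit [b_i] as a positive iterate of a point of
    [D]. So the two inverse maps agree all along. *)
Lemma bpt_backward_paired i : (0 < i < n)%N -> forall k, k < 0 ->
  itinside true (bpt a i) k = itinside false (bpt a i) k.
Proof.
move=> hi k k0; set w := bpt a i.
have dw s : dom s w by apply: dom_bpt.
have negS (m : nat) : - m.+1%:Z + 1 = - m%:Z by lia.
have inner (m : nat) : Tpowside true (- m%:Z) w = Tpowside false (- m%:Z) w ->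
    exists2 l : 'I_n, (forall s, Jside s l (Tpowside true (- m%:Z) w - tr l)) &
      forall s, Tpowside s (- m.+1%:Z) w = Tpowside true (- m%:Z) w - tr l.
  move=> e; have [||l wl] := @interior_K (Tpowside true (- m%:Z) w).
  - by apply: dom_both; [|rewrite e]; apply: Tpowside_dom.
  - move=> i' hi'; have [m' [j [m0 hj ->]]] := btau_from_D hi'.
    move=> /(congr1 (Tpowside true m%:Z)).
    rewrite -!Tpowside_add //; last exact: dom_bpt.
    rewrite subrr Tpowside0 => /esym; apply: keane_int => //; lia.
  exists l => s; first exact: Jside_interior.
  rewrite -Tpowside_pred // negS; have -> : Tpowside s (- m%:Z) w = Tpowside true (- m%:Z) w.
    by case: s.
  by apply: TinvsideE; rewrite Kside_subtr; apply: Jside_interior.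
have paired (m : nat) : Tpowside true (- m%:Z) w = Tpowside false (- m%:Z) w.
  elim: m => [|m IHm]; first by rewrite oppr0 !Tpowside0.
  by have [l _ step] := inner m IHm; rewrite !step.
have -> : k = - (`|k|%N.-1).+1%:Z by lia.
have [l Jl step] := inner `|k|%N.-1 (paired _).
by rewrite !itinsideE !step !(lettersideE (Jl _)).
Qed.

(** * Asymptotic pairs, and coincidences between the two kinds of itinerary *)

Lemma forward_determines_from s s' x y N : dom s x -> dom s' y ->
  (forall k, N <= k -> itinside s x k = itinside s' y k) ->
  Tpowside s N x = Tpowside s' N y.
Proof.
move=> domx domy eq_xy.
have cx := closed_orbit_shift N (closed_orbit_itin domx).
have cy := closed_orbit_shift N (closed_orbit_itin domy).
have := forward_determines cx cy; rewrite add0r; apply=> k k0.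
by apply: eq_xy; lia.
Qed.

Lemma backward_determines_from s s' x y N : dom s x -> dom s' y ->
  (forall k, k < N -> itinside s x k = itinside s' y k) ->
  Tpowside s N x = Tpowside s' N y.
Proof.
move=> domx domy eq_xy.
have cx := closed_orbit_shift N (closed_orbit_itin domx).
have cy := closed_orbit_shift N (closed_orbit_itin domy).
have := backward_determines cx cy; rewrite add0r; apply=> k k0.
by apply: eq_xy; lia.
Qed.

Lemma itinside_inj s x y : dom s x -> dom s y -> itinside s x = itinside s y -> x = y.
Proof.
move=> domx domy e; have := @forward_determines_from s s x y 0 domx domy.
by rewrite !Tpowside0; apply=> k _; rewrite e.
Qed.

Lemma pos_asymptotic_sides x y N : dom true x -> dom false y ->
  (forall k, N <= k -> itinside true x k = itinside false y k) ->
  itinside true x <> itinside false y ->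
  exists i k, (0 < i < n)%N /\
    (itinside true x = shiftk k (itinside true (btau a tau i)) /\
     itinside false y = shiftk k (itinside false (btau a tau i))).
Proof.
move=> domx domy eq_xy neq.
have zE := forward_determines_from domx domy eq_xy.
pose z := Tpowside true N x.
have [||||i [k [hi zw]]] := @first_backward_split z.
- exact: Tpowside_dom.
- by rewrite /z zE; apply: Tpowside_dom.
- move=> k k0; rewrite {2}/z zE !itinside_Tpow //.
  by apply: eq_xy; lia.
- move=> e; apply: neq; rewrite (itinside_back domx (erefl z)) e.
  by rewrite -(itinside_back domy (esym zE)).
(* [N] leads to the meeting point and [k] from there to the splitting point; the shift undoes
   both. *)
exists i, (- (k + N)); split=> //; split; apply: itinside_back => //.
  by rewrite Tpowside_add.
by rewrite Tpowside_add // -zE.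
Qed.

Lemma neg_asymptotic_sides x y N : dom true x -> dom false y ->
  (forall k, k < N -> itinside true x k = itinside false y k) ->
  itinside true x <> itinside false y ->
  exists i k, (0 < i < n)%N /\
    (itinside true x = shiftk k (itinside true (bpt a i)) /\
     itinside false y = shiftk k (itinside false (bpt a i))).
Proof.
move=> domx domy eq_xy neq.
have zE := backward_determines_from domx domy eq_xy.
pose z := Tpowside true N x.
have [||||i [k [hi zw]]] := @first_forward_split z.
- exact: Tpowside_dom.
- by rewrite /z zE; apply: Tpowside_dom.
- move=> k k0; rewrite {2}/z zE !itinside_Tpow //.
  by apply: eq_xy; lia.
- move=> e; apply: neq; rewrite (itinside_back domx (erefl z)) e.
  by rewrite -(itinside_back domy (esym zE)).
exists i, (- (k + N)); split=> //; split; apply: itinside_back => //.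
  by rewrite Tpowside_add.
by rewrite Tpowside_add // -zE.
Qed.

(** [T] sees a left end here, [Tt] the right end of the preceding interval. *)
Lemma itinside_bpt_neq i : (0 < i < n)%N ->
  itinside true (bpt a i) 0 <> itinside false (bpt a i) 0.
Proof.
case: i => // i lt_in; rewrite !itinsideE !Tpowside0.
rewrite (lettersideE (Jside_bpt (@Ordinal n i.+1 lt_in))).
by rewrite (lettersideE (Jside_bptS (@Ordinal n i (ltnW lt_in)))) /=; lia.
Qed.

(** The two orbits agree at all times. If they passed through some [b_i], its two itineraries would
    coincide, although they differ at time 0. *)
Lemma itin_eq_itint x y : dom true x -> dom false y ->
  itinside true x = itinside false y -> x = y /\ regular a tau x.
Proof.
move=> domx domy e.
have orb N : Tpowside true N x = Tpowside false N y.
  by apply: forward_determines_from => // k _; rewrite e.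
have xy : x = y by have := orb 0; rewrite !Tpowside0.
split=> //; have := dom_both domx; rewrite {1}xy => /(_ domy) x01.
split; first by lra.
do 2![split; first by lra].
move=> k _ [i [hi ->]] xk; apply: (itinside_bpt_neq hi).
have bx : bpt a i = Tpowside true (- k) x.
  by rewrite xk -Tpowside_add ?addNr ?Tpowside0 //; apply: dom_bpt.
rewrite {2}bx orb bx !itinside_Tpow //.
by rewrite /shiftk e.
Qed.

Lemma pos_asymptotic_sym (alpha beta : int -> nat) :
  pos_asymptotic alpha beta -> pos_asymptotic beta alpha.
Proof. by case=> N h; exists N => i /h. Qed.

Lemma neg_asymptotic_sym (alpha beta : int -> nat) :
  neg_asymptotic alpha beta -> neg_asymptotic beta alpha.
Proof. by case=> N h; exists N => i /h. Qed.

Lemma btau_pos_asymptotic i k : (0 < i < n)%N ->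
  pos_asymptotic (shiftk k (itinside true (btau a tau i)))
                 (shiftk k (itinside false (btau a tau i))).
Proof.
by move=> hi; exists (- k) => j jk; apply: btau_forward_paired => //; lia.
Qed.

Lemma bpt_neg_asymptotic i k : (0 < i < n)%N ->
  neg_asymptotic (shiftk k (itinside true (bpt a i)))
                 (shiftk k (itinside false (bpt a i))).
Proof.
(* The shifted times must stay below 0, where the letters differ. *)
by move=> hi; exists (k + 1) => j jk; apply: bpt_backward_paired => //; lia.
Qed.

(** Itineraries of the same map that agree eventually come from one point, so a distinct pair has
    one member from each map. *)
Lemma pos_asymptoticP alpha beta :
  inX a tau alpha -> inX a tau beta -> alpha <> beta ->
  (pos_asymptotic alpha beta <->
   exists (i : nat) (k : int), (0 < i < n)%N /\
     same_pair alpha beta (shiftk k (itinside true (btau a tau i)))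
                          (shiftk k (itinside false (btau a tau i)))).
Proof.
move=> Xa Xb; have [s [x [domx ->]]] := inX_itin Xa.
have [s' [y [domy ->]]] := inX_itin Xb => neq; split; last first.
  move=> [i [k [hi [] [-> ->]]]]; first exact: btau_pos_asymptotic.
  exact/pos_asymptotic_sym/btau_pos_asymptotic.
case=> N eqN.
have zE := forward_determines_from domx domy eqN.
case: s s' => -[] in domx domy neq eqN zE *.
- by case: neq; rewrite (Tpowside_inj domx domy zE).
- have [i [k [hi e]]] := pos_asymptotic_sides domx domy eqN neq.
  by exists i, k; split=> //; left.
- have [|/esym//|i [k [hi [e1 e2]]]] := pos_asymptotic_sides domy domx (N := N).
    by move=> k /eqN.
  by exists i, k; split=> //; right.
- by case: neq; rewrite (Tpowside_inj domx domy zE).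
Qed.

Lemma neg_asymptoticP alpha beta :
  inX a tau alpha -> inX a tau beta -> alpha <> beta ->
  (neg_asymptotic alpha beta <->
   exists (i : nat) (k : int), (0 < i < n)%N /\
     same_pair alpha beta (shiftk k (itinside true (bpt a i)))
                          (shiftk k (itinside false (bpt a i)))).
Proof.
move=> Xa Xb; have [s [x [domx ->]]] := inX_itin Xa.
have [s' [y [domy ->]]] := inX_itin Xb => neq; split; last first.
  move=> [i [k [hi [] [-> ->]]]]; first exact: bpt_neg_asymptotic.
  exact/neg_asymptotic_sym/bpt_neg_asymptotic.
case=> N eqN'.
(* The agreement includes time [-N], while the later lemmas use a strict bound. *)
have eqN k : k < 1 - N -> itinside s x k = itinside s' y k.
  by move=> kN; apply: eqN'; lia.
have zE := backward_determines_from domx domy eqN.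
case: s s' => -[] in domx domy neq eqN zE {eqN'} *.
- by case: neq; rewrite (Tpowside_inj domx domy zE).
- have [i [k [hi e]]] := neg_asymptotic_sides domx domy eqN neq.
  by exists i, k; split=> //; left.
- have [|/esym//|i [k [hi [e1 e2]]]] := neg_asymptotic_sides domy domx (N := 1 - N).
    by move=> k /eqN.
  by exists i, k; split=> //; right.
- by case: neq; rewrite (Tpowside_inj domx domy zE).
Qed.

(** * Doubly asymptotic pairs and split permutations *)

Lemma D_orbits_disjoint i j (k : int) : (0 < i < n)%N -> (0 < j < n)%N ->
  bpt a i = Tpowside true k (bpt a j) -> k = 0 /\ i = j.
Proof.
move=> hi hj e; case: (ltgtP k 0) => k0.
- exfalso; have : Tpowside true (- k) (bpt a i) = bpt a j.
    by rewrite e -Tpowside_add ?addNr ?Tpowside0 //; apply: dom_bpt.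
  by apply: keane_int => //; lia.
- by exfalso; apply: (keane_int hj hi k0).
- by split=> //; apply: bpt_inj; [lia|lia|rewrite e k0 Tpowside0].
Qed.

Lemma btau_not_regular k i : (0 < i < n)%N ->
  ~ regular a tau (Tpowside true k (btau a tau i)).
Proof.
move=> hi [_ [_ [_ noD]]]; have [m [j [_ hj iE]]] := btau_from_D hi.
apply: (noD (k + m) (bpt a j)); first by exists j.
by rewrite iE -Tpowside_add //; apply: dom_bpt.
Qed.

(* With [T b_p = b^tau_i], either [p > 0], [r = 1] and [j = p] is a position
   where [tau] fails to be split, or [p = 0], [r = 2] and the wrap-around
   conditions of full splitness fail. *)
Lemma fully_split_no_coincidence i j (r : int) : fully_split_perm tau ->
  (0 < i < n)%N -> (0 < j < n)%N ->
  ~ (forall s, btau a tau i = Tpowside s r (bpt a j)).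
Proof.
case=> split_tau wrap /andP[i0 lt_in] hj wE; have dj s := dom_bpt s hj.
pose p := (tau^-1)%g (Ordinal lt_in).
have tau_p : tau p = i :> nat by rewrite permKV.
have Tp : Tside true (bpt a p) = btau a tau i by rewrite Tside_bpt tau_p.
have dp : dom true (bpt a p) := Jside_dom (Jside_bpt p).
have pull s k x : dom s x -> Tside s x = Tpowside s k (bpt a j) ->
    x = Tpowside s (k - 1) (bpt a j).
  by move=> domx; rewrite -{1}(subrK 1 k) Tpowside_succ // => /Tside_inj; apply; rewrite ?Tpowside_dom.
have {}Tp : bpt a p = Tpowside true (r - 1) (bpt a j) by apply: pull; rewrite // Tp.
have [j0 lt_jn] := andP hj.
have lt_j1 : (j.-1 < n)%N by lia.
pose j1 := Ordinal lt_j1.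
have TjS : Tside false (bpt a j) = btau a tau (tau j1).+1.
  by rewrite -Tside_bptS /= prednK.
case: (posnP p) => [pz|p0].
  have [q q0 [tau_q Tq]] := zero_from_D.
  have [|||r2 qj] := @D_orbits_disjoint q j (r - 1 - 1).
  - by rewrite q0 ltn_ord.
  - exact: hj.
  - apply: pull; first exact: Jside_dom (Jside_bpt q).
    by rewrite Tq -Tp pz bpt0.
  have lt_i1 : (i.-1 < n)%N by lia.
  (* The letter whose image interval ends at [b^tau_i], so that [Tt] sends the right end of its
     interval there. *)
  pose q' := (tau^-1)%g (Ordinal lt_i1).
  have tau_q' : (tau q').+1 = i by rewrite permKV /= prednK.
  have : bpt a q'.+1 = Tpowside false (r - 1) (bpt a j).
    apply: pull; first exact: Jside_dom (Jside_bptS q').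
    by rewrite Tside_bptS tau_q'.
  have -> : r - 1 = 0 + 1 by lia.
  rewrite Tpowside_succ // Tpowside0 TjS => e.
  have lt_q' := ltn_ord q'; have lt_t := ltn_ord (tau j1).
  (* If [Tt b_j] is in [D^tau], then the right end of [q'] is a point of [D] reached from [D] in
     positive time. Otherwise both equal 1, so [q'] is the last letter while [p] is the first. *)
  have [lt_e|ge_e] := ltnP (tau j1).+1 n.
    have /(btau_in01 tau a_gt0 a_sum) e01 : (0 < (tau j1).+1 < n)%N by [].
    have q'n : (q'.+1 < n)%N.
      rewrite ltn_neqAle lt_q' andbT; apply/eqP => q'n.
      by move: e01; rewrite -e q'n bpt_n ltxx andbF.
    have [m [j' [m0 hj' ]]] := @btau_from_D (tau j1).+1 lt_e.
    rewrite -e => /(@D_orbits_disjoint q'.+1 j' m q'n hj') [mz _].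
    by lia.
  have e1 : (tau j1).+1 = n by lia.
  move: e; rewrite e1 btau_n // -bpt_n => /bpt_inj q'n.
  have [|h _] := wrap p q' pz; first by lia.
  by apply: h; rewrite tau_q' tau_p.
have [|r1 pj] := @D_orbits_disjoint p j (r - 1) _ hj Tp.
  by rewrite p0 ltn_ord.
(* With [r = 1] and [p = j], the images of the intervals on both sides of [b_j] are still
   adjacent. *)
have := wE false; have -> : r = 0 + 1 by lia.
rewrite Tpowside_succ // Tpowside0 TjS => /(btau_inj a_gt0) i_eq.
apply: (split_tau j1 p); first by rewrite /= pj prednK.
by rewrite tau_p; apply: i_eq => //; apply: ltnW.
Qed.

(** A distinct pair would come from both [D^tau] and [D]. Matching the two descriptions side by side
    gives one [r] carrying [b_j] to [b^tau_i] under both maps. *)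
Lemma fully_split_asymptotic alpha beta : fully_split_perm tau ->
  inX a tau alpha -> inX a tau beta -> doubly_asymptotic alpha beta -> alpha = beta.
Proof.
move=> fs Xa Xb [pos neg]; apply: contrapT => neq.
have [i [k [hi Pi]]] := (pos_asymptoticP Xa Xb neq).1 pos.
have [j [m [hj Pj]]] := (neg_asymptoticP Xa Xb neq).1 neg.
have di s := dom_btau s hi; have dj s := dom_bpt s hj.
(* An itinerary of [T] equal to one of [Tt] belongs to a regular point, which an orbit through [D]
   or [D^tau] does not contain; so the sides match. *)
have conflict s s' : shiftk k (itinside s (btau a tau i)) = shiftk m (itinside s' (bpt a j)) ->
    s = s' /\ btau a tau i = Tpowside s (- k + m) (bpt a j).
  rewrite -!itinside_Tpow //.
  have dI s1 k1 := @Tpowside_dom s1 k1 _ (di s1).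
  have dJ s1 k1 := @Tpowside_dom s1 k1 _ (dj s1).
  have back s1 : Tpowside s1 k (btau a tau i) = Tpowside s1 m (bpt a j) ->
      btau a tau i = Tpowside s1 (- k + m) (bpt a j).
    by move=> e; rewrite Tpowside_add // -e -Tpowside_add // addNr Tpowside0.
  case: s s' => -[] e.
  - by split=> //; apply: back; apply: itinside_inj e.
  - by have [_ /btau_not_regular] := itin_eq_itint (dI _ _) (dJ _ _) e.
  - have [xy reg] := itin_eq_itint (dJ _ _) (dI _ _) (esym e).
    case: reg => _ [_ [_ noD]]; exfalso.
    by apply: (noD m (bpt a j)); first by exists j.
  - by split=> //; apply: back; apply: itinside_inj e.
apply: (@fully_split_no_coincidence i j (- k + m) fs hi hj) => s.
case: Pi Pj => -[-> ->] [[e1 e2]|[e1 e2]].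
- by case: s; [have [] := conflict _ _ e1|have [] := conflict _ _ e2].
- by have [] := conflict _ _ e1.
- by have [] := conflict _ _ e1.
- by case: s; [have [] := conflict _ _ e2|have [] := conflict _ _ e1].
Qed.

(** If two neighbouring intervals stay adjacent, both maps send their common end [b_j] to the same
    point of [D^tau]. The itineraries of [b_j] then differ at time 0 only. *)
Lemma not_split_asymptotic : ~ split_perm tau ->
  exists alpha beta, inX a tau alpha /\ inX a tau beta /\
    alpha <> beta /\ doubly_asymptotic alpha beta.
Proof.
move=> /existsNP[i /existsNP[j /not_implyP[ji /contrapT tau_ij]]].
have hj : (0 < j < n)%N by rewrite ltn_ord andbT ji.
have dj s := dom_bpt s hj.
exists (itinside true (bpt a j)), (itinside false (bpt a j)).
split; first exact: itin_inX.
split; first exact: itin_inX.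
split; first by move=> e; apply: (itinside_bpt_neq hj); rewrite e.
split; last first.
  have [N h] := bpt_neg_asymptotic 0 hj; exists N => k /h.
  by rewrite /shiftk addr0.
have hw : (0 < tau j < n)%N by rewrite ltn_ord andbT tau_ij.
have TE s : Tpowside s 1 (bpt a j) = btau a tau (tau j).
  rewrite -[1]add0r Tpowside_succ // Tpowside0; case: s; first exact: Tside_bpt.
  by rewrite ji Tside_bptS tau_ij.
rewrite (itinside_back (dj true) (TE true)) (itinside_back (dj false) (TE false)).
exact: btau_pos_asymptotic.
Qed.

End TwoSided.

(** * Irreducibility at the first letter, and the conclusion *)

Lemma irreducible_perm_ord0 (n : nat) (tau : {perm 'I_n}) : (2 <= n)%N ->
  irreducible_perm tau ->
  forall l : 'I_n, l = 0%N :> nat -> tau l != 0%N :> nat.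
Proof.
move=> n2 irr l l0; apply/eqP => tau_l0; have /negP := irr 1%N n2; apply.
apply/eqP/setP => v; rewrite !inE ltnS leqn0.
apply/imsetP/eqP => [[i]|v0].
  rewrite inE ltnS leqn0 => /eqP i0 ->.
  by have -> : i = l by apply: val_inj; rewrite /= i0 l0.
by exists l; [rewrite inE l0|apply: val_inj; rewrite /= tau_l0].
Qed.

Theorem theorem4p5 (R : realType) (n : nat) (a : 'I_n -> R) (tau : {perm 'I_n}) :
  (2 <= n)%N ->
  (forall i, 0 < a i) ->
  \sum_(i < n) a i = 1 ->
  irreducible_perm tau ->
  keane a tau ->
  (* (i) *)
  (forall alpha beta : int -> nat,
     inX a tau alpha -> inX a tau beta -> alpha <> beta ->
     (pos_asymptotic alpha beta <->
      exists (i : nat) (k : int), (0 < i < n)%N /\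
        same_pair alpha beta (shiftk k (itin a tau (btau a tau i)))
                             (shiftk k (itint a tau (btau a tau i))))) /\
  (* (ii) *)
  (forall alpha beta : int -> nat,
     inX a tau alpha -> inX a tau beta -> alpha <> beta ->
     (neg_asymptotic alpha beta <->
      exists (i : nat) (k : int), (0 < i < n)%N /\
        same_pair alpha beta (shiftk k (itin a tau (bpt a i)))
                             (shiftk k (itint a tau (bpt a i))))) /\
  (* (iii) *)
  (forall x y : R, 0 <= x < 1 -> 0 < y <= 1 ->
     itin a tau x = itint a tau y -> x = y /\ regular a tau x) /\
  (* (iv) *)
  (fully_split_perm tau ->
     forall alpha beta : int -> nat, inX a tau alpha -> inX a tau beta ->
       doubly_asymptotic alpha beta -> alpha = beta) /\
  (~ split_perm tau ->
     exists alpha beta : int -> nat, inX a tau alpha /\ inX a tau beta /\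
       alpha <> beta /\ doubly_asymptotic alpha beta).
Proof.
move=> n2 a_gt0 a_sum irr keaneT; have tau0 := irreducible_perm_ord0 n2 irr.
split; first by move=> alpha beta; apply: pos_asymptoticP.
split; first by move=> alpha beta; apply: neg_asymptoticP.
split; first by move=> x y; apply: itin_eq_itint.
split; first by move=> fs alpha beta; apply: fully_split_asymptotic.
exact: not_split_asymptotic.
Qed.
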